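(* Let $K$ be a field and let $\kappa$ be an arbitrary cardinal. Then the following are equivalent: (1) $|K|>\kappa$ or $\kappa$ is finite. (2) Any field $L\supseteq K$ that is generated as a $K$-algebra (i.e. as a ring over $K$) by at most $\kappa$ elements is algebraic over $K$. *)

(* Defs.v *)
From HB Require Import structures.
From mathcomp Require Import all_boot all_order all_algebra.
From mathcomp Require Import boolp classical_sets functions cardinality.

Set Implicit Arguments.
Unset Strict Implicit.
Unset Printing Implicit Defensive.

Import GRing.Theory.

Local Open Scope classical_set_scope.
Local Open Scope card_scope.
Local Open Scope ring_scope.

Definition card_gt (T U : Type) : Prop :=
  [set: U] #<= [set: T] /\ ~ ([set: T] #<= [set: U]).

Section GeneratedAlgebra.
Variables (K L : fieldType) (iota : {rmorphism K -> L}).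

Definition subalgebra (A : set L) : Prop :=
  subring_closed [in A] /\ range iota `<=` A.

Definition generated_algebra (S : set L) : set L := smallest subalgebra S.

(* [L] is generated by [S] as a ring over [K]; inverses are not adjoined. *)
Definition generates_algebra (S : set L) : Prop :=
  generated_algebra S = [set: L].

Definition algebraic_extension : Prop := forall x : L, algebraicOver iota x.

End GeneratedAlgebra.

(* Main.v *)
(**
  From (1) to (2): suppose that t in L is transcendental over K. By Zorn, pick a
  subring F of L containing K, maximal with t transcendental over F; maximality
  makes every y in L algebraic over F[t], hence integral over F[t][1/d_y] for
  some nonzero d_y in F[X].  Let M be a multiplicative set of polynomials that
  contains all d_y, for y a generator.  Then L is integral over F[t][1/M], so
  for u in F[X] nonzero, 1/u(t), being integral over a ring containing u(t),
  belongs to it, and u divides an element of M.  This fails if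
  - there are finitely many generators, u = 1 + X * \prod d_y, and M is the set
    of polynomials coprime to u (this proves Zariski's lemma);
  - |K| > kappa is infinite, u = X - a with a in K a root of no d_y (such an a
    exists since the d_y have at most kappa roots altogether), and M is the set
    of polynomials not vanishing at a.
  From (2) to (1): if kappa is infinite and |K| <= kappa, then the field K(X) has
  at most kappa elements, and hence is generated by as many.
*)

From HB Require Import structures.
Require Import Defs.
From mathcomp Require Import all_boot all_order all_algebra.
From mathcomp Require Import finmap boolp classical_sets functions cardinality.

Set Implicit Arguments.
Unset Strict Implicit.
Unset Printing Implicit Defensive.

Import GRing.Theory.

Local Open Scope classical_set_scope.
Local Open Scope card_scope.

(** * Cardinal arithmetic *)

Lemma inj_card_leTT (T U : Type) (f : T -> U) :
  injective f -> [set: T] #<= [set: U].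
Proof.
move=> finj; rewrite -(card_le_eql (inj_card_eq (A := [set: T]) (f := f) _)).
  exact: card_leT.
by move=> x y _ _; apply: finj.
Qed.

(** The injection is made a total function, with junk value [u0] outside [A], so that it applies
    without membership proofs. *)
Lemma card_le_fun (T U : Type) (A : set T) (B : set U) (u0 : U) :
  A #<= B -> exists2 f : T -> U, (forall x, A x -> B (f x)) &
    (forall x y, A x -> A y -> f x = f y -> x = y).
Proof.
move=> /card_leP[f].
pose g x := if pselect (A x) is left Ax then val (f (SigSub (mem_set Ax))) else u0.
have gE x (Ax : A x) : g x = val (f (SigSub (mem_set Ax))).
  rewrite /g; case: pselect => // Ax'; congr (val (f _)); exact: val_inj.
exists g => [x Ax|x y Ax Ay]; first by rewrite gE; exact: set_valP.
by rewrite !gE => /val_inj/(@inj _ _ _ f); rewrite !inE => /(_ I I)[].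
Qed.

Lemma card_leTT_inj (T U : Type) :
  [set: T] #<= [set: U] -> exists f : T -> U, injective f.
Proof.
move=> /card_leP[f]; exists (fun x => \val (f (SigSub (mem_setT x)))) => x y.
by move=> /val_inj/(@inj _ _ _ f); rewrite !inE => /(_ I I)[].
Qed.

Lemma card_le_rel (T U : Type) (A : set T) (B : set U) (G : T -> U -> Prop) :
    (forall x, A x -> exists2 y, B y & G x y) ->
    (forall x x' y, G x y -> G x' y -> x = x') ->
  A #<= B.
Proof.
move=> Gtot Ginj.
pose g (x : A) := cid2 (Gtot _ (set_valP x)).
pose f (x : A) : B := SigSub (mem_set (s2valP (g x))).
have finj : injective f.
  move=> x y /(congr1 val) /= fxy; apply: val_inj; apply: Ginj (s2valP' (g x)) _.
  by rewrite fxy; exact: s2valP'.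
rewrite -(card_le_eql (card_setT A)) -(card_le_eqr (card_setT B)).
exact: inj_card_leTT finj.
Qed.

(** Zorn's lemma on graphs of injective partial maps from [A] to [B]: a maximal one that is neither
    total nor onto could be extended by a pair. *)
Lemma card_le_total (T U : Type) (A : set T) (B : set U) : A #<= B \/ B #<= A.
Proof.
pose P (G : set (T * U)) := G `<=` A `*` B /\
  forall p q, G p -> G q -> p.1 = q.1 <-> p.2 = q.2.
have [F FP Ftot|G [[GAB Ginj] Gmax]] := @Zorn_bigcup _ P.
  split=> [p [X FX Xp]|p q [X FX Xp] [Y FY Yq]]; first exact: (FP _ FX).1.
  have [XY|YX] := Ftot _ _ FX FY.
    by apply: (FP _ FY).2 => //; apply: XY.
  by apply: (FP _ FX).2 => //; apply: YX.
have [domG|] := pselect (forall x, A x -> exists y, G (x, y)).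
  left; apply: (@card_le_rel _ _ _ _ (fun x y => G (x, y))) => [x Ax|x x' y Gx Gx'].
    by have [y Gxy] := domG x Ax; exists y => //; have [] := GAB _ Gxy.
  exact/(Ginj _ _ Gx Gx').
have [ranG _|] := pselect (forall y, B y -> exists x, G (x, y)).
  right; apply: (@card_le_rel _ _ _ _ (fun y x => G (x, y))) => [y By|y y' x Gy Gy'].
    by have [x Gxy] := ranG y By; exists x => //; have [] := GAB _ Gxy.
  exact/(Ginj _ _ Gy Gy').
move=> /existsNP[y /not_implyP[By /forallNP Ny]].
move=> /existsNP[x /not_implyP[Ax /forallNP Nx]]; exfalso.
apply: (Gmax (G `|` [set (x, y)])).
  by split=> [p Gp|/(_ (x, y))GU]; [left|apply: (Nx y); apply: GU; right].
split=> [p [Gp|->]|]; [exact: GAB|by []|].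
move=> [p1 p2] [q1 q2] [Gp|[-> ->]] [Gq|[-> ->]] //=.
- exact: Ginj Gp Gq.
- by split=> e; [move: Gp; rewrite e => /Nx|move: Gp; rewrite e => /Ny].
- by split=> e; [move: Gq; rewrite -e => /Nx|move: Gq; rewrite -e => /Ny].
Qed.

(** Hessenberg's theorem on the square of an infinite cardinal, with a curried pairing map. *)
Lemma infinite_square_inj (T : Type) :
  infinite_set [set: T] -> exists f : T -> T -> T,
    forall x y x' y', f x y = f x' y' -> x = x' /\ y = y'.
Proof.
move=> Tinf.
(* Zorn on the pairs (X, f) with f an injection X * X -> X, where f is a total
   function of which only the values on X * X matter. *)
pose sq (p : set T * (T -> T -> T)) := [/\ exists a b, [/\ p.1 a, p.1 b & a <> b],
  forall x y, p.1 x -> p.1 y -> p.1 (p.2 x y) &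
  forall x y x' y', p.1 x -> p.1 y -> p.1 x' -> p.1 y' ->
    p.2 x y = p.2 x' y' -> x = x' /\ y = y'].
have [p0 sq0] : exists p, sq p.
  have [g ginj] : exists g : nat -> T, injective g by apply/card_leTT_inj/infiniteP.
  (* [h] inverts [g] on its range and is 0 elsewhere; it carries the pairing of [nat] over to
     [range g]. *)
  have [h hg] : exists h : T -> nat, cancel g h.
    exists (fun x => xget 0%N [set n | g n = x]) => n.
    by apply: ginj; apply: (@xgetPex _ 0%N [set m | g m = g n]); exists n.
  exists (range g, fun x y => g (choice.pickle (h x, h y))); split => /=.
  - by exists (g 0), (g 1); split; [exists 0|exists 1|move/ginj].
  - by move=> x y _ _; exists (choice.pickle (h x, h y)).
  - move=> _ _ _ _ [a _ <-] [b _ <-] [c _ <-] [d _ <-].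
    by rewrite !hg => /ginj/(pcan_inj choice.pickleK)[-> ->].
pose R (u v : {p | sq p}) := `[< (sval u).1 `<=` (sval v).1 /\
  forall x y, (sval u).1 x -> (sval u).1 y -> (sval u).2 x y = (sval v).2 x y >].
have Rxx u : R u u by apply/asboolP; split=> [x|].
have [| |A Atot|[[X f] sqX] Rmax] := @ZL_preorder _ (exist _ p0 sq0) R.
- exact: Rxx.
- move=> u v w /asboolP[uv1 uv2] /asboolP[vw1 vw2]; apply/asboolP.
  split=> [x /uv1/vw1//|x y ux uy].
  by rewrite uv2// vw2//; apply: uv1.
- have [[u0 Au0]|A0] := pselect (exists u, A u); last first.
    by exists (exist _ p0 sq0) => u Au; case: A0; exists u.
  pose X := \bigcup_(u in A) (sval u).1.
  pose F x y z := exists u, [/\ A u, (sval u).1 x, (sval u).1 y & (sval u).2 x y = z].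
  have common x y : X x -> X y -> exists u, [/\ A u, (sval u).1 x & (sval u).1 y].
    move=> [u Au ux] [v Av vy]; have [/asboolP[uv _]|/asboolP[vu _]] := Atot _ _ Au Av.
      by exists v; split=> //; apply: uv.
    by exists u; split=> //; apply: vu.
  have common2 u v : A u -> A v -> exists w, [/\ A w, R u w & R v w].
    move=> Au Av; have [uv|vu] := Atot _ _ Au Av.
      by exists v; split.
    by exists u; split.
  (* Members of the chain agree on common pairs, so any of them gives the value; [x] is a junk value
     for pairs that no member covers. *)
  pose f x y : T := if pselect (exists z, F x y z) is left e then sval (cid e) else x.
  have fE u x y : A u -> (sval u).1 x -> (sval u).1 y -> f x y = (sval u).2 x y.
    move=> Au ux uy; rewrite /f; case: pselect => [e|[]]; last first.
      by exists ((sval u).2 x y), u.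
    have [v [Av vx vy <-]] := svalP (cid e).
    have [w [_ /asboolP[uw1 uw2] /asboolP[vw1 vw2]]] := common2 _ _ Au Av.
    by rewrite uw2// vw2.
  have sqX : sq (X, f).
    split=> /= [|x y Xx Xy|x y x' y' Xx Xy Xx' Xy'].
    + case: (svalP u0) => -[a [b [ua ub ab]]] _ _.
      by exists a, b; split=> //; exists u0.
    + have [u [Au ux uy]] := common _ _ Xx Xy; rewrite (fE u)//; exists u => //.
      by case: (svalP u) => _ uc _; apply: uc.
    + have [u [Au ux uy]] := common _ _ Xx Xy.
      have [v [Av vx vy]] := common _ _ Xx' Xy'.
      have [w [Aw /asboolP[uw _] /asboolP[vw _]]] := common2 _ _ Au Av.
      rewrite !(fE w) ?(uw, vw)//; [|exact: vw..|exact: uw|exact: uw].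
      by case: (svalP w) => _ _ wi; apply: wi; do ?[exact: uw|exact: vw].
  exists (exist _ _ sqX) => u Au; apply/asboolP; split=> /= [x ux|x y ux uy].
    by exists u.
  by rewrite (fE u).
have {}Rmax Y F : sq (Y, F) -> X `<=` Y ->
    (forall x y, X x -> X y -> f x y = F x y) -> Y `<=` X.
  move=> sqY XY fF; suff /Rmax/asboolP[] : R (exist _ _ sqX) (exist _ _ sqY) by [].
  exact/asboolP.
have [[a [b [/= Xa Xb ab]]] /= fX finj] := sqX.
(* If the complement of X is no larger than X, then T injects into X. Otherwise
   a copy of X in the complement extends f, contradicting maximality. *)
have [CX|XC] := card_le_total (~` X) X.
  have [g gX ginj] := card_le_fun a CX.
  (* The tags [a] and [b] keep the images of [X] and of its complement apart. *)
  pose j x := if pselect (X x) then f a x else f b (g x).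
  have jX x : X (j x) by rewrite /j; case: pselect => [?|nXx]; apply: fX => //; exact: gX.
  have jinj : injective j.
    move=> x y; rewrite /j; case: pselect => [Xx|nXx]; case: pselect => [Xy|nXy].
    - by move=> /finj[].
    - by move=> /finj[]// ; exact: gX.
    - by move=> /finj[]//; [exact: gX|move=> /esym].
    - by move=> /finj[]//; [exact: gX..|move=> _; exact: ginj].
  by exists (fun x y => f (j x) (j y)) => x y x' y' /finj[]// /jinj -> /jinj ->.
have [g gC ginj] := card_le_fun a XC.
pose Y := X `|` g @` X.
(* [h] folds [Y] onto [X]; together with the tag below, which tells the two copies apart, it
   determines a point of [Y]. *)
have [h [hX hg]] : exists h : T -> T, (forall x, X x -> h x = x) /\
    forall x, X x -> h (g x) = x.
  exists (fun y => if pselect (X y) then y else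
    if pselect (exists2 x, X x & g x = y) is left e then s2val (cid2 e) else y).
  split=> x Xx; case: pselect => //= [/(gC _ Xx)//|_].
  by case: pselect => [e|[]]; [case: cid2 => /= z Xz /ginj->|exists x].
pose tag x := if pselect (X x) then a else b.
have Xtag x : X (tag x) by rewrite /tag; case: pselect.
have Yh y : Y y -> X (h y) by move=> [Xy|[x Xx <-]]; [rewrite hX|rewrite hg].
have htag x y : Y x -> Y y -> h x = h y -> tag x = tag y -> x = y.
  rewrite /tag => -[Xx|[u Xu <-]] [Xy|[v Xv <-]];
    rewrite ?(hg _ Xu) ?(hg _ Xv) ?(hX _ Xx) ?(hX _ Xy)//.
  - by case: pselect => //= _; case: pselect => /= [/(gC _ Xv)//|_ _ /ab].
  - by case: pselect => /= [/(gC _ Xu)//|_]; case: pselect => //= _ _ /esym/ab.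
  - by move->.
(* Pairs outside the square of [X] go to the new copy, encoded by their images under [h] and their
   tags. *)
pose F x y := if pselect (X x /\ X y) then f x y
  else g (f (f (h x) (h y)) (f (tag x) (tag y))).
have Xin x y : Y x -> Y y -> X (f (f (h x) (h y)) (f (tag x) (tag y))).
  by move=> /Yh Yx /Yh Yy; apply: (fX); apply: (fX).
have sqY : sq (Y, F).
  split=> /= [|x y Yx Yy|x y x' y' Yx Yy Yx' Yy'].
  - by exists a, b; split=> //; left.
  - rewrite /F; case: pselect => /= [[Xx Xy]|_]; first by left; apply: fX.
    by right; exists (f (f (h x) (h y)) (f (tag x) (tag y))) => //; exact: Xin.
  - rewrite /F; case: pselect => /= [[Xx Xy]|_]; case: pselect => /= [[Xx' Xy']|_].
    + exact: finj.
    + by move=> e; case: (gC _ (Xin _ _ Yx' Yy')); rewrite -e; apply: fX.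
    + by move=> e; case: (gC _ (Xin _ _ Yx Yy)); rewrite e; apply: fX.
    + move=> /(ginj _ _ (Xin _ _ Yx Yy) (Xin _ _ Yx' Yy')).
      move=> /finj[]; [by apply: fX; exact: Yh|exact: fX| | |].
      * by apply: fX; exact: Yh.
      * exact: fX.
      move=> /finj[]; [exact: Yh..|move=> hx hy].
      by move=> /finj[]// tx ty; split; exact: htag.
case: (gC _ Xa); apply: (Rmax _ _ sqY); [by left| |by right; exists a].
by move=> x y Xx Xy; rewrite /F; case: pselect => //= -[].
Qed.

(** Folding the pairing map is injective on lists of each fixed length; pairing the result with the
    length does the rest. *)
Lemma infinite_seq_inj (T : Type) :
  infinite_set [set: T] -> exists f : seq T -> T, injective f.
Proof.
move=> Tinf; have [f finj] := infinite_square_inj Tinf.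
have [g ginj] : exists g : nat -> T, injective g by apply/card_leTT_inj/infiniteP.
pose e := foldr f (g 0).
have einj s s' : size s = size s' -> e s = e s' -> s = s'.
  by elim: s s' => [|x s IHs] [|x' s'] //= [/IHs{}IHs] /finj[-> /IHs->].
exists (fun s => f (g (size s)) (e s)) => s s' /finj[/ginj + +].
exact: einj.
Qed.

(** * Integral closure in a field *)

Local Open Scope ring_scope.

(** A ring type is needed as the source of the map in [integralOver]. *)
Definition subring_sub (L : fieldType) (A : subringClosed L) := {x : L | x \in A}.
HB.instance Definition _ (L : fieldType) (A : subringClosed L) :=
  SubChoice.on (subring_sub A).
HB.instance Definition _ (L : fieldType) (A : subringClosed L) :=
  [SubChoice_isSubComNzRing of subring_sub A by <:].

Definition integral_closure (L : fieldType) (A : subringClosed L) : set L :=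
  [set x | integralOver (val : subring_sub A -> L) x].

Lemma integral_closure_subring (L : fieldType) (A : subringClosed L) :
  GRing.subring_closed [in integral_closure A].
Proof.
split=> [|x y|x y]; rewrite !inE.
- exact: integral1.
- exact: integral_sub.
- exact: integral_mul.
Qed.

Lemma sub_integral_closure (L : fieldType) (A : subringClosed L) x :
  x \in A -> integral_closure A x.
Proof. by move=> Ax; exact: (integral_id _ (exist _ x Ax : subring_sub A)). Qed.

(** The coefficients are integral over [A], so transitivity of integrality applies without lifting
    [p] to the subring type. *)
Lemma integral_closure_root (L : fieldType) (A : subringClosed L) (p : {poly L}) y :
  p \is monic -> p \is a polyOver A -> p.[y] = 0 -> integral_closure A y.
Proof.
move=> pmon /polyOverP pA py0; apply: integral_root_monic pmon _ _.
  exact/rootP.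
by apply/integral_poly => i; exact: sub_integral_closure.
Qed.

(* Multiply the equation of [x^-1] by a power of [x]. *)
Lemma integral_inv_mem (L : fieldType) (A : subringClosed L) x :
  x \in A -> x != 0 -> integral_closure A x^-1 -> x^-1 \in A.
Proof.
move=> Ax x0 [p pmon /rootP].
have v0 := rmorph0 (val : subring_sub A -> L).
rewrite horner_coef (size_map_inj_poly val_inj v0).
have pn0 : (0 < size p)%N by rewrite size_poly_gt0 monic_neq0.
have := monicP pmon; rewrite /lead_coef.
case: (size p) pn0 => // n _ pn1.
have vpn1 : (map_poly (val : subring_sub A -> L) p)`_n = 1.
  by rewrite coef_map_id0// [p`_n]pn1 rmorph1.
rewrite big_ord_recr/= vpn1 mul1r => /eqP.
rewrite addrC addr_eq0 => /eqP e.
case: n => [|n] in pn1 vpn1 e *.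
  by move: e; rewrite big_ord0 oppr0 expr0 => /eqP; rewrite oner_eq0.
have -> : x^-1 = x ^+ n * x^-1 ^+ n.+1.
  by rewrite exprS mulrCA -exprMn divff// expr1n mulr1.
rewrite e mulrN rpredN mulr_sumr rpred_sum// => i _; rewrite coef_map_id0//= mulrCA.
rewrite rpredM ?(valP p`_i)// -[in x ^+ n](subnK (ltn_ord i : (i <= n)%N)).
by rewrite exprD -mulrA -exprMn divff// expr1n mulr1 rpredX.
Qed.

(** * Localizations of F[t] *)

Section Localization.
Variables (L : fieldType) (F : subringClosed L) (t : L) (M : set {poly L}).

(** This is F[t][1/M] inside [L]; [M] holds polynomials rather than their values at [t], so that it
    can be described by coprimality or by roots. *)
Definition localization : set L :=
  [set x | exists2 wd : {poly L} * {poly L},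
     wd.1 \is a polyOver F /\ M wd.2 & x = wd.1.[t] / wd.2.[t]].

Hypotheses (M1 : M 1) (MM : forall d e, M d -> M e -> M (d * e))
  (MF : forall d, M d -> d \is a polyOver F) (Mt : forall d, M d -> d.[t] != 0).

Lemma localization_subring : GRing.subring_closed [in localization].
Proof.
split=> [|x y|x y]; rewrite !inE /localization.
- by exists (1, 1); rewrite /= ?rpred1// hornerC divr1.
- move=> [[w d] /= [wF Md] ->] [[v e] /= [vF Me] ->].
  exists (w * e - v * d, d * e) => /=.
    by split; [apply: rpredB; apply: rpredM => //; exact: MF|exact: MM].
  by rewrite -mulNr addf_div ?Mt// !hornerE mulNr.
- move=> [[w d] /= [wF Md] ->] [[v e] /= [vF Me] ->].
  exists (w * v, d * e) => /=; first by split; [rewrite rpredM|exact: MM].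
  by rewrite mulf_div !hornerE.
Qed.

Lemma horner_localization w : w \is a polyOver F -> localization w.[t].
Proof. by move=> wF; exists (w, 1) => //=; rewrite hornerC divr1. Qed.

Lemma horner_div_localization w d :
  w \is a polyOver F -> M d -> localization (w.[t] / d.[t]).
Proof. by move=> wF Md; exists (w, d). Qed.

End Localization.

(** * Maximal subrings over which an element is transcendental *)

Definition transcendental_over (L : fieldType) (F : {pred L}) (t : L) :=
  forall p, p \is a polyOver F -> p.[t] = 0 -> p = 0.

(* [d] is the leading coefficient of a polynomial equation for [y] over [F[t]]. *)
Definition denominator (L : fieldType) (F : {pred L}) (t y : L) (d : {poly L}) :=
  exists2 r : {poly {poly L}}, (forall i, r`_i \is a polyOver F) &
    lead_coef r = d /\ (map_poly (horner_eval t) r).[y] = 0.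

(** Dividing the equation by [d.[t]] makes it monic, and its coefficients become fractions in the
    localization. *)
Lemma denominator_integral (L : fieldType) (F : subringClosed L) (t y : L)
    (M : set {poly L}) (A : subringClosed L) (d : {poly L}) :
    {subset localization F t M <= A} -> M d -> d.[t] != 0 ->
  denominator F t y d -> integral_closure A y.
Proof.
move=> locA Md dt0 [r rF [rd rty]].
pose q := (d.[t])^-1 *: map_poly (horner_eval t) r.
have cq i : q`_i = (r`_i).[t] / d.[t].
  by rewrite coefZ coef_map mulrC.
apply: (@integral_closure_root _ _ q).
- by rewrite monicE lead_coefZ lead_coef_map_eq rd /= ?mulVf// /horner_eval.
- apply/polyOverP => i; rewrite cq.
  by apply/locA/mem_set/horner_div_localization => //; exact: rF.
- by rewrite /q hornerZ rty mulr0.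
Qed.

Lemma generated_mem (K L : fieldType) (iota : {rmorphism K -> L}) (S A : set L) :
    generates_algebra iota S -> GRing.subring_closed [in A] ->
    range iota `<=` A -> S `<=` A -> forall x, A x.
Proof.
move=> genS Ar AK SA x.
have : generated_algebra iota S x by rewrite genS.
exact: smallest_sub.
Qed.

(** All generators, hence all elements of [L], are integral over the localization. It contains
    [u.[t]], hence also the inverse, say w(t)/d(t); as [t] is transcendental, d(t) = u(t) w(t) lifts
    to d = u w. *)
Lemma mulclosed_contains_multiple (K L : fieldType) (iota : {rmorphism K -> L})
    (S : set L) (F : subringClosed L) (t : L) (M : set {poly L}) (u : {poly L}) :
    generates_algebra iota S -> (forall a, iota a \in F) ->
    transcendental_over F t ->
    M 1 -> (forall d e, M d -> M e -> M (d * e)) -> (forall d, M d -> d != 0) ->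
    (forall d, M d -> d \is a polyOver F) ->
    (forall y, S y -> exists2 d, M d & denominator F t y d) ->
    u != 0 -> u \is a polyOver F ->
  exists2 w, w \is a polyOver F & M (u * w).
Proof.
move=> genS FK ttr M1 MM M0 MF denM u0 uF.
have tn0 d : d \is a polyOver F -> d != 0 -> d.[t] != 0.
  by move=> dF; apply: contra_neq => /ttr->.
have Mt d : M d -> d.[t] != 0 by move=> Md; rewrite tn0 ?MF ?M0.
pose A : subringClosed L := HB.pack (fun x => x \in localization F t M)
  (GRing.isSubringClosed.Build _ _ (localization_subring M1 MM MF Mt)).
have locA x : localization F t M x -> x \in A by move=> /mem_set.
have utA : u.[t] \in A by apply/locA/horner_localization.
have intA : forall x, integral_closure A x.
  apply: (generated_mem genS (integral_closure_subring A)).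
    move=> _ [a _ <-]; apply/sub_integral_closure/locA.
    by rewrite -[iota a](hornerC _ t); apply: horner_localization; rewrite ?polyOverC.
  move=> y /denM[d Md]; apply: denominator_integral Md (Mt _ Md).
  by move=> x; apply.
have := integral_inv_mem utA (tn0 _ uF u0) (intA _) => /set_mem[[w d] /= [wF Md] e].
exists w => //; suff <- : d = u * w by [].
apply/eqP; rewrite -subr_eq0; apply/eqP/ttr.
  by apply: rpredB; [exact: (MF d)|exact: rpredM].
rewrite !hornerE; apply/eqP; rewrite subr_eq0; apply/eqP.
rewrite -[LHS]mul1r -[in LHS](divff (tn0 _ uF u0)) e -mulrA; congr (_ * _).
by rewrite mulfVK ?Mt.
Qed.

Definition adjoin (L : fieldType) (F : {pred L}) (y : L) : set L :=
  [set p.[y] | p in [set p | p \is a polyOver F]].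

Lemma sub_adjoin (L : fieldType) (F : subringClosed L) (y x : L) :
  x \in F -> adjoin F y x.
Proof. by move=> xF; exists x%:P; rewrite ?hornerC//= polyOverC. Qed.

Lemma mem_adjoin (L : fieldType) (F : subringClosed L) (y : L) : adjoin F y y.
Proof. by exists 'X; rewrite ?hornerX//= polyOverX. Qed.

Lemma subring_adjoin (L : fieldType) (F : subringClosed L) (y : L) :
  GRing.subring_closed [in adjoin F y].
Proof.
split=> [|x z|x z]; rewrite !inE.
- by exists 1; rewrite ?hornerC//= rpred1.
- by move=> [p /= pF <-] [q /= qF <-]; exists (p - q); rewrite ?hornerE//= rpredB.
- by move=> [p /= pF <-] [q /= qF <-]; exists (p * q); rewrite ?hornerE//= rpredM.
Qed.

Lemma exists_maximal_transcendental (K L : fieldType) (iota : {rmorphism K -> L})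
    (t : L) : ~ algebraicOver iota t ->
  exists F : set L, [/\ subalgebra iota F, transcendental_over [in F] t &
    forall G, F `<` G -> subalgebra iota G -> ~ transcendental_over [in G] t].
Proof.
move=> talg.
(* [set0] is allowed as the union of the empty chain. *)
pose P (F : set L) := F = set0 \/ subalgebra iota F /\ transcendental_over [in F] t.
have PK : P (range iota).
  right; split; first split=> //.
    split=> [|x y|x y]; rewrite !inE.
    - by exists 1; rewrite ?rmorph1.
    - by move=> [a _ <-] [b _ <-]; exists (a - b); rewrite ?rmorphB.
    - by move=> [a _ <-] [b _ <-]; exists (a * b); rewrite ?rmorphM.
  (* A relation with coefficients in the image of [K] lifts to [K], where it must be trivial. *)
  move=> p pK pt0.
  have /choice[f fP] : forall i, exists a, iota a = p`_i.
    move=> i; have [pi|pi] := ltnP i (size p).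
      by have /set_mem[a _ <-] := allP pK _ (mem_nth 0 pi); exists a.
    by exists 0; rewrite rmorph0 nth_default.
  pose q := \poly_(i < size p) f i.
  have pq : p = map_poly iota q.
    apply/polyP => i; rewrite coef_map coef_poly; case: ltnP => pi /=.
      by rewrite fP.
    by rewrite rmorph0 nth_default.
  apply: contra_notP talg => /eqP p0; exists q; last by rewrite -pq; exact/rootP.
  by move: p0; rewrite pq map_poly_eq0.
have [C CP Ctot|F [[F0|[Falg Ftr]] Fmax]] := @Zorn_bigcup _ P.
- have [[X [CX X0]]|CE] := pselect (exists X, C X /\ X !=set0); last first.
    left; rewrite -subset0 => x [X CX Xx]; apply: CE; exists X; split=> //; by exists x.
  have common x y : (\bigcup_(Y in C) Y) x -> (\bigcup_(Y in C) Y) y ->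
      exists Y, [/\ C Y, Y x & Y y].
    move=> [Y CY Yx] [Z CZ Zy]; have [YZ|ZY] := Ctot _ _ CY CZ.
      by exists Z; split=> //; apply: YZ.
    by exists Y; split=> //; apply: ZY.
  have good Y y : C Y -> Y y -> subalgebra iota Y /\ transcendental_over [in Y] t.
    by move=> CY Yy; have [Y0|] := CP _ CY => //; rewrite Y0 in Yy.
  have [x Xx] := X0.
  have [[[X1 _ _] KX] Xtr] := good _ _ CX Xx.
  right; split; first split.
  + split=> [|a b|a b]; rewrite !inE.
    * by exists X => //; exact: set_mem.
    * move=> ha hb; have [Y [CY Ya Yb]] := common _ _ ha hb.
      have [[[_ YB _] _] _] := good _ _ CY Ya; exists Y => //.
      by apply/set_mem/YB; exact: mem_set.
    * move=> ha hb; have [Y [CY Ya Yb]] := common _ _ ha hb.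
      have [[[_ _ YM] _] _] := good _ _ CY Ya; exists Y => //.
      by apply/set_mem/YM; exact: mem_set.
  + by move=> a /KX Xa; exists X.
  + move=> p pC pt0.
    (* The finitely many coefficients of [p] lie in one member of the chain; taking it above [X]
       ensures that it is nonempty. *)
    have [Y [CY XY pY]] : exists Y, [/\ C Y, X `<=` Y & {subset (p : seq L) <= Y}].
      have : {subset (p : seq L) <= \bigcup_(Y in C) Y} by exact: (allP pC).
      elim: (p : seq L) => [_|a s IHs asC].
        by exists X; split.
      have [|Y [CY XY sY]] := IHs.
        by move=> z zs; apply: asC; rewrite inE zs orbT.
      have /set_mem[Z CZ Za] := asC a (mem_head _ _).
      have [YZ|ZY] := Ctot _ _ CY CZ.
        exists Z; split=> [//||z]; first exact: subset_trans XY YZ.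
        rewrite inE => /predU1P[->|/sY/set_mem/YZ]; exact: mem_set.
      exists Y; split=> // z; rewrite inE => /predU1P[->|/sY//].
      exact/mem_set/ZY.
    have [_] := good _ _ CY (XY _ Xx); apply=> //; exact/allP.
- exfalso; apply: (Fmax (range iota)) PK; rewrite F0.
  by split=> // /(_ (iota 0)); apply; exists 0.
- by exists F; split=> // G FG Galg Gtr; apply: (Fmax G FG); right.
Qed.

(** For [y] in [F], X - y will do. Otherwise [t] is algebraic over F[y], and a relation for [t] over
    F[y] is also an equation for [y] over F[t]. *)
Lemma exists_denominator (L : fieldType) (F : subringClosed L) (t y : L) :
    transcendental_over F t ->
    y \in F \/ ~ transcendental_over [in adjoin F y] t ->
  exists d, [/\ d != 0, d \is a polyOver F & denominator F t y d].
Proof.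
move=> Ftr [yF|].
  exists 1; split; rewrite ?oner_eq0 ?rpred1//; exists ('X - (y%:P)%:P).
    by move=> i; rewrite coefB coefX coefC; apply: rpredB;
      [exact: rpred_nat|case: ifP; rewrite ?rpred0 ?polyOverC].
  rewrite lead_coefXsubC; split=> //.
  by rewrite rmorphB /= map_polyX map_polyC /= /horner_eval !hornerE subrr.
move=> /existsNP[q /not_implyP[qFy /not_implyP[qt0 /eqP q0]]].
have /choice[f fP] : forall i, exists p, p \is a polyOver F /\ p.[y] = q`_i.
  move=> i; have [iq|qi] := ltnP i (size q).
    by have /set_mem[p pF pq] := allP qFy _ (mem_nth 0 iq); exists p.
  by exists 0; rewrite rpred0 horner0 nth_default.
(* [q(t) = 0] is an equation B(t, y) = 0 over F; exchange the roles of t and y. *)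
pose B : {poly {poly L}} := \poly_(i < size q) f i.
have qB : map_poly (horner_eval y) B = q.
  apply/polyP => i; rewrite coef_map coef_poly -(fP i).2.
  case: ltnP => // qi; rewrite /= /horner_eval horner0.
  by rewrite (fP i).2 nth_default.
have B0 : B != 0 by apply: contra_neq q0 => B0; rewrite -qB B0 rmorph0.
have rF i : (swapXY B)`_i \is a polyOver F.
  apply/polyOverP => j; rewrite coef_swapXY coef_poly.
  by case: ifP; rewrite ?coef0 ?rpred0// => _; apply/polyOverP; case: (fP j).
exists (lead_coef (swapXY B)); split; rewrite ?lead_coef_eq0 ?swapXY_eq0//.
  exact: rF.
exists (swapXY B) => //; split=> //.
by rewrite -horner_polyC -horner2_swapXY horner_swapXY qB.
Qed.

Lemma exists_transcendental_tower (K L : fieldType) (iota : {rmorphism K -> L})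
    (t : L) : ~ algebraicOver iota t ->
  exists F : subringClosed L, [/\ forall a, iota a \in F, transcendental_over F t &
    forall y, exists d, [/\ d != 0, d \is a polyOver F & denominator F t y d]].
Proof.
move=> /exists_maximal_transcendental[F0 [[F0r KF0] F0tr F0max]].
pose F : subringClosed L := HB.pack (fun x => x \in F0)
  (GRing.isSubringClosed.Build _ _ F0r).
exists F; split=> [a||y]; first by apply/mem_set/KF0; exists a.
  exact: F0tr.
apply: exists_denominator; first exact: F0tr.
(* If [y] is not in [F], then F[y] is strictly larger, and maximality makes [t] algebraic over
   it. *)
have [yF|yF] := boolP (y \in F); [by left|right; apply: F0max].
  split=> [x Fx|sub]; first by apply: sub_adjoin; exact: mem_set.
  by move/negP: yF; apply; apply/mem_set/sub/mem_adjoin.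
split; first exact: subring_adjoin.
by move=> _ [a _ <-]; apply: sub_adjoin; apply/mem_set/KF0; exists a.
Qed.

(** * The two implications *)

Lemma finite_roots (L : fieldType) (p : {poly L}) :
  p != 0 -> finite_set [set x | root p x].
Proof.
move=> p0; apply: contrapT => /(infinite_set_fset (size p))[B Bp].
apply/negP; rewrite -ltnNge; apply: max_poly_roots p0 _ (fset_uniq _).
by apply/allP => x xB; apply: Bp.
Qed.

Lemma finitely_generated_algebraic (K L : fieldType) (iota : {rmorphism K -> L})
    (S : set L) :
  finite_set S -> generates_algebra iota S -> algebraic_extension iota.
Proof.
move=> /finite_seqP[s Ss] genS t; apply: contrapT => /exists_transcendental_tower.
move=> [F [KF Ftr /choice[d dP]]].
pose d0 := \prod_(y <- s) d y.
have d0F : d0 \is a polyOver F by apply: rpred_prod => y _; case: (dP y).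
have d00 : d0 != 0 by rewrite prodf_seq_neq0; apply/allP => y _; case: (dP y).
(* As [d0] is nonzero, [u] is not constant; it is coprime to [d0], hence to [d y] for each [y] in
   [s]. *)
pose u : {poly L} := 1 + d0 * 'X.
have u1 : (1 < size u)%N.
  by rewrite /u addrC size_polyDl ?size_mulX// ?size_poly1 ltnS size_poly_gt0.
have u0 : u != 0 by rewrite -size_poly_gt0 (ltn_trans _ u1).
have ud0 : coprimep u d0.
  by rewrite coprimep_sym /u addrC mulrC coprimep_addl_mul coprimep1.
pose M := [set e | e \is a polyOver F /\ coprimep u e].
have [] := @mulclosed_contains_multiple _ _ _ _ F t M u genS KF Ftr => //.
- by split; [exact: rpred1|exact: coprimep1].
- by move=> a b [aF ua] [bF ub]; split; [exact: rpredM|rewrite coprimepMr ua].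
- move=> a [_]; apply: contraTneq => ->; rewrite coprimep0.
  by rewrite -size_poly_eq1 gtn_eqF.
- by move=> a [].
- move=> y Sy; have [dy0 dyF dy] := dP y; exists (d y) => //; split=> //.
  apply: coprimep_dvdl ud0; rewrite /d0 (big_rem y) ?dvdp_mulr//.
  by move: Sy; rewrite Ss.
- by rewrite /u rpredD ?rpred1// rpredM// polyOverX.
(* If [u] divided an element of [M], it would be coprime to itself, hence constant. *)
- move=> w wF [_]; rewrite coprimepMr coprimepp => /andP[/eqP u1'].
  by rewrite u1' in u1.
Qed.

Lemma small_generated_algebraic (K L : fieldType) (iota : {rmorphism K -> L})
    (S : set L) (kappa : Type) :
  infinite_set [set: kappa] -> ~ ([set: K] #<= [set: kappa]) ->
  S #<= [set: kappa] -> generates_algebra iota S -> algebraic_extension iota.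
Proof.
move=> kinf Kk Sk genS t; apply: contrapT => /exists_transcendental_tower.
move=> [F [KF Ftr /choice[d dP]]].
have [a ad] : exists a, forall y, S y -> (d y).[iota a] != 0.
  (* Otherwise each a in [K] gives a root of some [d y]; coding a by [y] and the number that [r y]
     assigns to this root embeds [K] into [kappa]. *)
  apply: contrapT => /forallNP Na; apply: Kk.
  have [f finj] := infinite_square_inj kinf.
  have [h hinj] : exists h : nat -> kappa, injective h by apply/card_leTT_inj/infiniteP.
  have [g _ ginj] := card_le_fun (h 0%N) Sk.
  have /choice[r rinj] : forall y, exists r : L -> nat, forall x x',
      root (d y) x -> root (d y) x' -> r x = r x' -> x = x'.
    move=> y; have [dy0 _ _] := dP y.
    have /(card_le_fun 0%N)[r _ rinj] : [set x | root (d y) x] #<= [set: nat].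
      exact/finite_set_countable/finite_roots.
    by exists r.
  apply: (@card_le_rel _ _ _ _ (fun a z => exists y,
    [/\ S y, root (d y) (iota a) & z = f (g y) (h (r y (iota a)))])).
    move=> a _; have /existsNP[y /not_implyP[Sy dya]] := Na a.
    exists (f (g y) (h (r y (iota a)))) => //; exists y; split=> //.
    by apply/negPn/negP.
  move=> b b' _ [y [Sy yb ->]] [y' [Sy' yb' /finj[/(ginj _ _ Sy Sy') yy' /hinj]]].
  by rewrite -yy' in yb' * => /(rinj _ _ _ yb yb')/fmorph_inj.
pose M := [set e | e \is a polyOver F /\ e.[iota a] != 0].
have [] := @mulclosed_contains_multiple _ _ _ _ F t M ('X - (iota a)%:P) genS KF Ftr.
- by split; [exact: rpred1|rewrite hornerC oner_neq0].
- by move=> b c [bF ba] [cF ca]; split; [exact: rpredM|rewrite hornerM mulf_neq0].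
- by move=> b [_]; apply: contraNneq => ->; rewrite horner0.
- by move=> b [].
- by move=> y Sy; have [dy0 dyF dy] := dP y; exists (d y) => //; split=> //; exact: ad.
- by rewrite polyXsubC_eq0.
- by rewrite rpredB ?polyOverX ?polyOverC.
- by move=> w wF [_]; rewrite !hornerE subrr mul0r eqxx.
Qed.

(** Evaluating [p] at the fraction X gives [p] itself as a fraction, which is nonzero. *)
Lemma tofracX_not_algebraic (K : fieldType) :
  ~ algebraicOver (@tofrac {poly K} \o polyC) (tofrac 'X).
Proof.
move=> [p p0 /rootP].
rewrite map_poly_comp horner_map /= -/(comp_poly _ _) comp_polyXr => /eqP.
by rewrite tofrac_eq0; apply/negP.
Qed.

(** A fraction is coded by the numerator and denominator of a chosen representative, a polynomial by
    its list of coefficients. *)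
Lemma card_fraction_poly_le (K : fieldType) (kappa : Type) :
  infinite_set [set: kappa] -> [set: K] #<= [set: kappa] ->
  [set: {fraction {poly K}}] #<= [set: kappa].
Proof.
move=> kinf /card_leTT_inj[g ginj].
have [f finj] := infinite_square_inj kinf.
have [h hinj] := infinite_seq_inj kinf.
pose e (p : {poly K}) := h (map g p).
have einj : injective e by move=> p q /hinj/(inj_map ginj)/val_inj.
pose num_den (x : {fraction {poly K}}) := val (generic_quotient.repr x).
apply: (@inj_card_leTT _ _ (fun x => f (e (num_den x).1) (e (num_den x).2))) => x y.
move=> /finj[/einj nxy /einj dxy].
apply/(can_inj generic_quotient.reprK)/val_inj.
by apply/eqP; rewrite -pair_eqE; apply/andP; split; apply/eqP.
Qed.

Theorem theorem38 (K : fieldType) (kappa : Type) :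
  (card_gt K kappa \/ finite_set [set: kappa]) <->
  (forall (L : fieldType) (iota : {rmorphism K -> L}) (S : set L),
     S #<= [set: kappa] -> generates_algebra iota S ->
     algebraic_extension iota).
Proof.
split=> [kK L iota S Sk genS|alg].
  have [kfin|kinf] := pselect (finite_set [set: kappa]).
    exact: finitely_generated_algebraic (card_le_finite Sk kfin) genS.
  case: kK => // -[_ Kk].
  exact: small_generated_algebraic kinf Kk Sk genS.
have [kfin|kinf] := pselect (finite_set [set: kappa]); [by right|left].
apply: contrapT => /not_andP kK.
(* By comparability of cardinals, the failure of [card_gt] gives |K| <= kappa. *)
have Kk : [set: K] #<= [set: kappa].
  by have [//|kK'] := card_le_total [set: K] [set: kappa]; case: kK => [//|/contrapT].
apply: (@tofracX_not_algebraic K).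
(* All elements of K(X) are taken as generators. *)
apply: (alg _ (@tofrac {poly K} \o polyC) setT); first exact: card_fraction_poly_le.
by apply/seteqP; split=> // x _ A [_]; apply.
Qed.
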